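(* Let $M$ be an orientable Riemannian $d$-manifold. If $M$ is stably parallelizable, then $TM$ admits a Parseval frame of size $d+1$. Moreover, if $H^1(M,\mathbb{Z}/2\mathbb{Z})=0$, then the converse also holds: if $TM$ admits a Parseval frame of size $d+1$, then $M$ is stably parallelizable.
   Context: A $d$-manifold $M$ is stably parallelizable if $TM\oplus\mathbb{R}$ is a trivial vector bundle, where $\mathbb{R}$ denotes the trivial real line bundle $M\times\mathbb{R}\to M$. A Parseval frame of size $n$ for $TM$ is a collection of $n$ smooth sections $\sigma_1,\dots,\sigma_n$ of $TM$ such that for every $p\in M$ and $v\in T_pM$, $\sum_{j=1}^n|\langle v,\sigma_j(p)\rangle|^2=\|v\|^2$, where $\langle\cdot,\cdot\rangle$ is the Riemannian metric. *)

(* Defs.v *)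
From HB Require Import structures.
From mathcomp Require Import all_boot all_order all_algebra.
From mathcomp Require Import all_classical all_reals all_analysis.

Set Implicit Arguments.
Unset Strict Implicit.
Unset Printing Implicit Defensive.

Import Order.TTheory GRing.Theory Num.Theory.
Import numFieldNormedType.Exports.

Local Open Scope classical_set_scope.
Local Open Scope ring_scope.

(* [Cn k U f]: [f] is of class C^k on the open set [U].  As the source is
   finite-dimensional, [x |-> 'd f x] is of class C^k as a map into the linear
   maps iff [x |-> 'd f x v], which is ['D_v f], is so for each [v]. *)
Fixpoint Cn (R : realType) (V W : normedModType R) (k : nat)
    (U : set V) (f : V -> W) : Prop :=
  if k is k'.+1 then
    (forall x, U x -> differentiable f x) /\ (forall v, Cn k' U ('D_v f))
  else forall x, U x -> {for x, continuous f}.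

Definition smooth_on (R : realType) (V W : normedModType R)
  (U : set V) (f : V -> W) : Prop := forall k, Cn k U f.

(* A homeomorphism from an open subset of [M] onto an open subset of R^d.  The
   values of [chart_map] off [chart_dom], and of [chart_inv] off
   [chart_map @` chart_dom], are meaningless. *)
Record chart (R : realType) (M : topologicalType) (d : nat) := Chart {
  chart_dom : set M ;
  chart_map : M -> 'rV[R]_d ;
  chart_inv : 'rV[R]_d -> M ;
  chart_dom_open : open chart_dom ;
  chart_image_open : open (chart_map @` chart_dom) ;
  chart_mapK : forall p, chart_dom p -> chart_inv (chart_map p) = p ;
  chart_map_continuous : forall p, chart_dom p ->
    {for p, continuous chart_map} ;
  chart_inv_continuous : forall x, (chart_map @` chart_dom) x ->
    {for x, continuous chart_inv}
}.

Definition chart_image (R : realType) (M : topologicalType) (d : nat)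
  (a : chart R M d) : set 'rV[R]_d := chart_map a @` chart_dom a.

Definition transition (R : realType) (M : topologicalType) (d : nat)
  (a b : chart R M d) : 'rV[R]_d -> 'rV[R]_d := chart_map b \o chart_inv a.

Definition compatible (R : realType) (M : topologicalType) (d : nat)
    (a b : chart R M d) : Prop :=
  smooth_on (chart_map a @` (chart_dom a `&` chart_dom b)) (transition a b) /\
  smooth_on (chart_map b @` (chart_dom a `&` chart_dom b)) (transition b a).

Record smooth_manifold (R : realType) (d : nat) := SmoothManifold {
  carrier :> topologicalType ;
  atlas : set (chart R carrier d) ;
  manifold_hausdorff : hausdorff_space carrier ;
  manifold_second_countable : @second_countable carrier ;
  atlas_cover : forall p, exists2 a, atlas a & chart_dom a p ;
  atlas_compatible : forall a b, atlas a -> atlas b -> compatible a b ;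
  atlas_maximal : forall a, (forall b, atlas b -> compatible a b) -> atlas a
}.

Definition chart_at (R : realType) (d : nat) (M : smooth_manifold R d) (p : M)
  : set (chart R M d) := [set a | atlas a /\ chart_dom a p].

(* ['J f x] acts on row vectors: ['d f x u = u *m 'J f x]. *)
Definition transition_jacobian (R : realType) (d : nat)
    (M : smooth_manifold R d) (p : M) (a b : chart R M d) : 'M[R]_d :=
  'J (transition a b) (chart_map a p).

Definition orientable (R : realType) (d : nat) (M : smooth_manifold R d)
    : Prop :=
  exists A : set (chart R M d),
    [/\ A `<=` atlas (s := M),
        forall p, exists2 a, A a & chart_dom a p &
        forall a b p, A a -> A b -> chart_dom a p -> chart_dom b p ->
          0 < \det (transition_jacobian p a b)].

(* A tangent vector at [p] is the family of its components in all the charts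
   around [p], related by the usual transformation law.  Components in the
   remaining charts are set to 0, so that [tangent p] is a linear subspace of
   the function space [chart R M d -> 'rV[R]_d]. *)
Definition tangent (R : realType) (d : nat) (M : smooth_manifold R d) (p : M)
    : set (chart R M d -> 'rV[R]_d) :=
  [set v | (forall a, ~ chart_at p a -> v a = 0) /\
           (forall a b, chart_at p a -> chart_at p b ->
              v b = v a *m transition_jacobian p a b)].

(* The tangent vector at [p] with components [u] in the chart [a]. *)
Definition tangent_vector (R : realType) (d : nat) (M : smooth_manifold R d)
    (a : chart R M d) (p : M) (u : 'rV[R]_d) : chart R M d -> 'rV[R]_d :=
  fun b => if `[< chart_at p b >] then u *m transition_jacobian p a b else 0.

Definition smooth_vector_field (R : realType) (d : nat)
    (M : smooth_manifold R d) (X : M -> chart R M d -> 'rV[R]_d) : Prop :=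
  (forall p, tangent p (X p)) /\
  (forall a, atlas a ->
     smooth_on (chart_image a) (fun x => X (chart_inv a x) a)).

Record riemannian_metric (R : realType) (d : nat) (M : smooth_manifold R d) :=
  RiemannianMetric {
  metric :> forall p : M,
    (chart R M d -> 'rV[R]_d) -> (chart R M d -> 'rV[R]_d) -> R ;
  metric_sym : forall p u v, tangent p u -> tangent p v ->
    metric p u v = metric p v u ;
  metric_linear : forall p (c : R) u v w,
    tangent p u -> tangent p v -> tangent p w ->
    metric p (c *: u + v) w = c * metric p u w + metric p v w ;
  metric_pos : forall p v, tangent p v -> v <> 0 -> 0 < metric p v v ;
  metric_smooth : forall a, atlas a -> forall u v : 'rV[R]_d,
    smooth_on (chart_image a)
      (fun x => metric (chart_inv a x) (tangent_vector a (chart_inv a x) u)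
                                   (tangent_vector a (chart_inv a x) v))
}.

Definition metric_norm (R : realType) (d : nat) (M : smooth_manifold R d)
    (g : riemannian_metric M) (p : M) (v : chart R M d -> 'rV[R]_d) : R :=
  Num.sqrt (g p v v).

Definition parseval_frame (R : realType) (d : nat) (M : smooth_manifold R d)
    (g : riemannian_metric M) (n : nat)
    (s : 'I_n -> M -> chart R M d -> 'rV[R]_d) : Prop :=
  (forall j, smooth_vector_field (s j)) /\
  (forall p v, tangent p v ->
     \sum_(j < n) `|g p v (s j p)| ^+ 2 = metric_norm g p v ^+ 2).

(* The fibre at [p] of the Whitney sum of TM and the trivial line bundle. *)
Definition stable_fiber (R : realType) (d : nat) (M : smooth_manifold R d)
    (p : M) : set ((chart R M d -> 'rV[R]_d) * R) := tangent p `*` setT.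

(* An isomorphism of smooth vector bundles, over the identity of [M], from
   TM (+) R to the product bundle M x R^(d+1): [Phi p] is a linear bijection on
   each fibre, with inverse [Psi p], and the maps induced by [Phi] and [Psi]
   between the total spaces are smooth.  Smoothness is read in the coordinates
   of the total spaces induced by the charts [a] of [M], namely
   (p, (v, t)) |-> (chart_map a p, (v a, t)) and
   (p, w) |-> (chart_map a p, w). *)
Definition stable_trivialization (R : realType) (d : nat)
    (M : smooth_manifold R d)
    (Phi : M -> (chart R M d -> 'rV[R]_d) * R -> 'rV[R]_d.+1)
    (Psi : M -> 'rV[R]_d.+1 -> (chart R M d -> 'rV[R]_d) * R) : Prop :=
  [/\ forall p (c : R) e f, stable_fiber p e -> stable_fiber p f ->
        Phi p (c *: e.1 + f.1, c * e.2 + f.2) = c *: Phi p e + Phi p f,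
      forall p w, stable_fiber p (Psi p w) /\ Phi p (Psi p w) = w,
      forall p e, stable_fiber p e -> Psi p (Phi p e) = e,
      forall a, atlas a ->
        smooth_on (V := ('rV[R]_d * ('rV[R]_d * R))%type)
          (chart_image a `*` setT)
          (fun z => Phi (chart_inv a z.1)
                        (tangent_vector a (chart_inv a z.1) z.2.1, z.2.2)) &
      forall a, atlas a ->
        smooth_on (V := ('rV[R]_d * 'rV[R]_d.+1)%type)
          (W := ('rV[R]_d * R)%type)
          (chart_image a `*` setT)
          (fun z => ((Psi (chart_inv a z.1) z.2).1 a,
                     (Psi (chart_inv a z.1) z.2).2))].

Definition stably_parallelizable (R : realType) (d : nat)
  (M : smooth_manifold R d) : Prop :=
  exists Phi Psi, stable_trivialization (M := M) Phi Psi.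

Definition std_simplex (R : realType) (n : nat) : set 'rV[R]_n.+1 :=
  [set x | (forall i, 0 <= x ord0 i) /\ \sum_i x ord0 i = 1].
Arguments std_simplex : clear implicits.

(* Insertion of a zero coordinate in position [i]. *)
Definition insert0 (R : realType) (n : nat) (i : 'I_n.+2) (x : 'rV[R]_n.+1)
    : 'rV[R]_n.+2 :=
  \row_j (if unlift i j is Some k then x ord0 k else 0).

Lemma insert0_simplex (R : realType) (n : nat) (i : 'I_n.+2) (x : 'rV[R]_n.+1) :
  std_simplex R n x -> std_simplex R n.+1 (insert0 i x).
Proof.
move=> [x0 x1]; split=> [j|]; first by rewrite mxE; case: unliftP.
rewrite (bigD1_ord i) //= mxE unlift_none add0r -[RHS]x1.
by apply: eq_bigr => k _; rewrite mxE liftK.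
Qed.

Lemma insert0_continuous (R : realType) (n : nat) (i : 'I_n.+2) :
  continuous (@insert0 R n i).
Proof.
move=> x A [P xP PA]; exists (fun k l => P k (lift i l)) => [k l|y yP] /=.
  by have := xP k (lift i l); rewrite mxE liftK (ord1 k).
apply: PA => k j; rewrite mxE; case: unliftP => [l ->|->].
  by rewrite (ord1 k); exact: yP.
by apply: nbhs_singleton; have := xP k i; rewrite mxE unlift_none.
Qed.

Definition face (R : realType) (n : nat) (i : 'I_n.+2)
    (x : std_simplex R n) : std_simplex R n.+1 :=
  exist _ (insert0 i (set_val x)) (mem_set (insert0_simplex i (set_valP x))).

Lemma face_continuous (R : realType) (n : nat) (i : 'I_n.+2) :
  continuous (@face R n i).
Proof.
apply: continuous_comp_initial => x.
apply: (@continuous_comp _ _ _ set_val (@insert0 R n i)).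
  exact: initial_continuous.
exact: insert0_continuous.
Qed.

Definition singular_simplex (R : realType) (X : topologicalType) (n : nat) :=
  {s : std_simplex R n -> X | continuous s}.

Definition simplex_face (R : realType) (X : topologicalType) (n : nat)
    (s : singular_simplex R X n.+1) (i : 'I_n.+2) : singular_simplex R X n :=
  exist (fun s => continuous s) (sval s \o face i)
    (fun x => continuous_comp (@face_continuous R n i x) (svalP s _)).

(* Homomorphisms from the free abelian group on the singular [n]-simplices to
   [G]. *)
Definition cochain (R : realType) (X : topologicalType) (G : zmodType)
  (n : nat) := singular_simplex R X n -> G.

Definition coboundary (R : realType) (X : topologicalType) (G : zmodType)
    (n : nat) (c : cochain R X G n) : cochain R X G n.+1 :=
  fun s => \sum_(i < n.+2) c (simplex_face s i) *~ (-1) ^+ i.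

Definition cocycles (R : realType) (X : topologicalType) (G : zmodType)
    (n : nat) : set (cochain R X G n) :=
  [set c | coboundary c = (fun=> 0)].

Definition coboundaries (R : realType) (X : topologicalType) (G : zmodType)
    (n : nat) : set (cochain R X G n) :=
  if n is m.+1 then range (@coboundary R X G m) else [set (fun=> 0)].

Definition cohomology_trivial (R : realType) (X : topologicalType)
    (G : zmodType) (n : nat) : Prop :=
  @cocycles R X G n `<=` @coboundaries R X G n.

(* Main.v *)
Require Import Defs.
From mathcomp Require Import all_boot all_order all_algebra.
From mathcomp Require Import all_classical all_reals all_analysis.
From HB Require Import structures.
From mathcomp Require Import ring.

(* Forward: a trivialization of TM (+) R gives a global frame; orthonormalizing
   it for the metric g + dt^2 and projecting to TM gives a Parseval frame, since
   the projection of an orthonormal basis is a Parseval frame.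

   Converse: by Parseval, v |-> (g v s_j)_j is an isometric embedding of TM into
   M x R^(d+1).  Its orthogonal complement is a line bundle L with TM (+) L
   trivial.  As M is orientable, L has a global unit section: the normalized
   generalized cross product of the images of the coordinate vectors of a
   positively oriented chart.  Hence L is trivial. *)

Set Implicit Arguments.
Unset Strict Implicit.
Unset Printing Implicit Defensive.

Import Order.TTheory GRing.Theory Num.Theory.
Import numFieldNormedType.Exports.

Local Open Scope classical_set_scope.
Local Open Scope ring_scope.

(** * Smooth functions *)

(** Smoothness has to be checked in every chart of a maximal atlas, so both directions are turned
    into matrix formulas in a chart, built from sums, products and the inverse square root of a
    positive function. This dictates the orthonormalization: Gram-Schmidt becomes a recursively
    defined matrix [C] with [C G C^T = 1] for the Gram matrix [G], whose pivots are positive, and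
    [C^T C = G^-1] then yields the Parseval identity. In the converse the obstacle is the sign of
    the normal. A change of chart with Jacobian [J] multiplies the cross product by [det J], hence
    its normalization by the sign of [det J]. Positively oriented charts therefore agree on the
    normal, but the atlas also contains orientation-reversing charts, and charts that preserve
    orientation on one component only; there the normal is recovered up to a locally constant
    sign. *)

(** A first-order expansion only sees the germ at [x], so the expansion of [f] is also one of [g];
    uniqueness of the continuous linear part identifies the differentials. *)
Lemma near_eq_differentiable (R : realType) (V W : normedModType R)
    (f g : V -> W) (x : V) :
  (\near x, f x = g x) -> differentiable f x ->
  'd g x = 'd f x :> (V -> W) /\ differentiable g x.
Proof.
move=> fg df; have fgx : f x = g x := nbhs_singleton fg.
have dg : g \o shift x = cst (g x) + 'd f x +o_ 0 id.
  have /eqaddoP H := diff_locally df.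
  have fg0 : \forall y \near 0, f (y + x) = g (y + x).
    by move: (fg); rewrite (near_shift 0 x) subr0.
  apply/eqaddoP => e e0.
  apply: filterS2 fg0 (H e e0) => y fgy.
  by rewrite !fctE /= fgy /cst fgx.
have E := diff_unique (diff_continuous df) dg.
by split=> //; apply/diff_locallyP; rewrite E; split=> //; exact: diff_continuous.
Qed.

Section Calculus.
Variable R : realType.
Implicit Types (V W X : normedModType R).

(** Charts have meaningless values off their domains, so functions can be rewritten on [U] only.
    Openness turns equality on [U] into equality near each point, which passes to the
    derivatives. *)
Lemma Cn_ext V W k (U : set V) (f g : V -> W) :
  open U -> {in U, f =1 g} -> Cn k U f -> Cn k U g.
Proof.
move=> oU; elim: k f g => [|k IH] f g fg /=.
  move=> cf x Ux; have nfg : \near x, f x = g x.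
    by apply: filterS (open_nbhs_nbhs (conj oU Ux)) => y /mem_set /fg.
  suff: g @ x --> f x by rewrite (fg x (mem_set Ux)).
  by apply: cvg_trans (cf x Ux); apply: near_eq_cvg.
move=> [df Df].
have nfg x : U x -> \near x, f x = g x.
  move=> Ux.
  by apply: filterS (open_nbhs_nbhs (conj oU Ux)) => y /mem_set /fg.
split=> [x Ux|v]; first by case: (near_eq_differentiable (nfg x Ux) (df x Ux)).
apply: IH (Df v) => x /set_mem Ux.
exact: near_eq_derive (nfg x Ux).
Qed.

Lemma Cn_sub V W k (U U' : set V) (f : V -> W) :
  U' `<=` U -> Cn k U f -> Cn k U' f.
Proof.
move=> UU; elim: k f => [|k IH] f /=; first by move=> cf x /UU /cf.
by move=> [df Df]; split=> [x /UU /df//|v]; exact: IH.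
Qed.

(** Each clause of [Cn] is a condition at one point on [f] and its iterated directional derivatives,
    so the clauses can be collected from different sets. *)
Lemma Cn_local V W k (U : set V) (f : V -> W) :
  (forall x, U x -> exists2 N : set V, N x & Cn k N f) -> Cn k U f.
Proof.
elim: k f => [|k IH] f /= H.
  by move=> x Ux; have [N Nx] := H x Ux; exact.
split=> [x Ux|v]; first by have [N Nx [+ _]] := H x Ux; exact.
by apply: IH => x Ux; have [N Nx [_ +]] := H x Ux; exists N.
Qed.

Lemma CnW V W k (U : set V) (f : V -> W) : Cn k.+1 U f -> Cn k U f.
Proof.
elim: k f => [|k IH] f; first by move=> [df _] x /df /differentiable_continuous.
by move=> [df Df]; split=> // v; apply: IH; apply: Df.
Qed.

Lemma Cn_cst V W k (U : set V) (c : W) : Cn k U (cst c : V -> W).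
Proof.
elim: k c => [|k IH] c; first by move=> x _; exact: cst_continuous.
split=> [x _|v]; first exact: differentiable_cst.
suff -> : 'D_v (cst c) = cst 0 :> (V -> W) by exact: IH.
by apply/funext => x; rewrite derive_cst.
Qed.

Lemma CnD V W k (U : set V) (f g : V -> W) : open U ->
  Cn k U f -> Cn k U g -> Cn k U (fun x => f x + g x).
Proof.
move=> oU; elim: k f g => [|k IH] f g.
  by move=> cf cg x Ux; apply: cvgD; [exact: cf|exact: cg].
move=> [df Df] [dg Dg]; split=> [x Ux|v].
  by apply: (differentiableD (df x Ux) (dg x Ux)).
apply: Cn_ext (IH _ _ (Df v) (Dg v)) => // x /set_mem Ux.
by rewrite -[RHS]/('D_v (f + g) x) deriveD //; apply: diff_derivable;
  [exact: df|exact: dg].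
Qed.

Lemma Cn_linl V W X k (U : set V) (f : V -> W) (L : {linear W -> X}) :
  open U -> continuous L -> Cn k U f -> Cn k U (fun x => L (f x)).
Proof.
move=> oU cL; elim: k f => [|k IH] f.
  by move=> cf x Ux; apply: continuous_comp; [exact: cf|exact: cL].
move=> [df Df].
have dL y : differentiable L y by exact: linear_differentiable.
split=> [x Ux|v]; first exact: (differentiable_comp (df x Ux) (dL _)).
apply: Cn_ext (IH _ (Df v)) => // x /set_mem Ux.
rewrite -[RHS]/('D_v (L \o f) x) (deriveE _ (df x Ux)) deriveE; last first.
  exact: (differentiable_comp (df x Ux) (dL _)).
by rewrite (diff_comp (df x Ux) (dL _)) /= (diff_lin _ cL).
Qed.

Lemma Cn_linear V W k (U : set V) (L : {linear V -> W}) :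
  open U -> continuous L -> Cn k U L.
Proof.
move=> oU cL; case: k => [|k]; first by move=> x _; exact: cL.
split=> [x Ux|v]; first exact: linear_differentiable.
suff -> : 'D_v L = cst (L v) :> (V -> W) by exact: Cn_cst.
apply/funext => x; rewrite deriveE; last exact: linear_differentiable.
by rewrite (diff_lin _ cL).
Qed.

(** The derivative along [v] of the composite is ['D_(L v) f] composed with the same affine map, so
    the induction closes on itself. The translation [c] serves to freeze one variable of a function
    on a product. *)
Lemma Cn_affr V W X k (U : set W) (U' : set V) (f : W -> X)
    (L : {linear V -> W}) (c : W) :
  open U' -> continuous L -> (forall x, U' x -> U (L x + c)) -> Cn k U f ->
  Cn k U' (fun x => f (L x + c)).
Proof.
move=> oU' cL UU; elim: k f => [|k IH] f.
  move=> cf x /UU Ux; apply: (@continuous_comp _ _ _ (fun x => L x + c) f).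
    by apply: cvgD; [exact: cL|exact: cvg_cst].
  exact: cf.
move=> [df Df].
have dL x : is_diff x (fun x => L x + c) L.
  have dLx : is_diff x L L.
    by split; [exact: linear_differentiable|exact: diff_lin].
  have := is_diffD dLx (is_diff_cst c x).
  by rewrite addr0.
have dfL x : U' x -> differentiable (f \o (fun x => L x + c)) x.
  by move=> /UU /df dfx; have [dLx _] := dL x; exact: differentiable_comp.
split=> [x Ux|v]; first exact: dfL.
apply: Cn_ext (IH _ (Df (L v))) => // x /set_mem U'x.
rewrite -[RHS]/('D_v (f \o (fun x => L x + c)) x).
rewrite deriveE; last exact: (df _ (UU _ U'x)).
rewrite deriveE; last exact: dfL.
have [dLx dLE] := dL x.
by rewrite (diff_comp dLx (df _ (UU _ U'x))) /= dLE.
Qed.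

Lemma CnM V k (U : set V) (f g : V -> R) : open U ->
  Cn k U f -> Cn k U g -> Cn k U (fun x => f x * g x).
Proof.
move=> oU; elim: k f g => [|k IH] f g.
  by move=> cf cg x Ux; apply: cvgM; [exact: cf|exact: cg].
move=> Cf Cg; have [df Df] := Cf; have [dg Dg] := Cg; split=> [x Ux|v].
  by apply: (differentiableM (df x Ux) (dg x Ux)).
have H := CnD oU (IH _ _ (CnW Cf) (Dg v)) (IH _ _ (CnW Cg) (Df v)).
apply: Cn_ext H => // x /set_mem Ux.
by rewrite -[RHS]/('D_v (f * g) x) deriveM //; apply: diff_derivable;
  [exact: df|exact: dg].
Qed.

(** With [h = f^(-1/2)], the derivative of [h] is [- 1/2 h^3 f']: a polynomial in [h] and [f'], to
    which the induction hypothesis at the lower order applies. *)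
Lemma Cn_rsqrt V k (U : set V) (f : V -> R) : open U ->
  (forall x, U x -> 0 < f x) ->
  Cn k U f -> Cn k U (fun x => (Num.sqrt (f x))^-1).
Proof.
move=> oU f0; elim: k => [|k IH].
  move=> cf x Ux; apply: cvgV; first by rewrite gt_eqF // sqrtr_gt0 f0.
  apply: (@continuous_comp _ _ _ f Num.sqrt); first exact: cf.
  exact: sqrt_continuous.
move=> Cf; have [df Df] := Cf.
have ds x : U x -> is_diff (f x) Num.sqrt ( *:%R^~ (2 * Num.sqrt (f x))^-1).
  move=> Ux; have := is_derive1_sqrt (f0 x Ux) => -[d1 d2].
  have dd : derivable Num.sqrt (f x) 1 by [].
  split; first exact/derivable1_diffP.
  by rewrite deriv1E // derive1E d2.
have sn0 x : U x -> Num.sqrt (f x) != 0.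
  by move=> Ux; rewrite gt_eqF // sqrtr_gt0 f0.
have dS x : U x -> differentiable (fun y => Num.sqrt (f y)) x.
  move=> Ux; have [dsx _] := ds x Ux.
  by apply: (@differentiable_comp _ _ _ _ f Num.sqrt); [exact: df|].
have dV x : U x -> differentiable (fun x => (Num.sqrt (f x))^-1) x.
  by move=> Ux; apply: differentiableV; [exact: dS|exact: sn0].
split=> // v.
have I := IH (CnW Cf).
have H := CnM oU (@Cn_cst _ _ k U (- 2^-1 : R))
                 (CnM oU (CnM oU I (CnM oU I I)) (Df v)).
apply: Cn_ext H => // x /set_mem Ux.
rewrite [RHS]deriveE; last exact: dV.
rewrite diffV; [|exact: dS|exact: sn0].
have [dsx dsE] := ds x Ux.
rewrite (@diff_comp _ _ _ _ f Num.sqrt) //; last exact: df.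
rewrite /= dsE deriveE; last exact: df.
rewrite /= /cst /GRing.scale /=.
have E (s t : R) : s != 0 ->
    - 2^-1 * (s^-1 * (s^-1 / s) * t) = - s ^- 2 * (t / (2 * s)).
  by move=> s0; field.
exact/E/sn0.
Qed.

End Calculus.

Lemma pair0_continuous (R : realType) (W X : normedModType R) :
  continuous (fun w : W => (w, 0 : X)).
Proof. by move=> x; apply: cvg_pair; [exact: cvg_id|exact: cvg_cst]. Qed.

Lemma pair0_linear (R : realType) (W X : normedModType R) :
  linear (fun w : W => (w, 0 : X)).
Proof. by move=> k u v; congr (_, _); rewrite /= scaler0 addr0. Qed.

Section Smooth.
Variables (R : realType) (V : normedModType R) (U : set V).
Hypothesis oU : open U.
Implicit Types (W X : normedModType R).

Lemma smooth_ext W (f g : V -> W) :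
  {in U, f =1 g} -> smooth_on U f -> smooth_on U g.
Proof. by move=> fg sf k; exact: Cn_ext (sf k). Qed.

Lemma smooth_cst W (c : W) : smooth_on U (fun=> c).
Proof. by move=> k; exact: Cn_cst. Qed.

Lemma smooth_linl W X (f : V -> W) (L : W -> X) :
  linear L -> continuous L -> smooth_on U f -> smooth_on U (fun x => L (f x)).
Proof.
move=> linL cL sf k.
pose LM := GRing.isLinear.Build _ _ _ _ _ linL.
pose LL : {linear W -> X} := HB.pack L LM.
exact: (@Cn_linl _ _ _ _ _ _ _ LL oU cL (sf k)).
Qed.

Lemma smooth_linear W (L : V -> W) :
  linear L -> continuous L -> smooth_on U L.
Proof.
move=> linL cL k.
pose LM := GRing.isLinear.Build _ _ _ _ _ linL.
pose LL : {linear V -> W} := HB.pack L LM.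
exact: (@Cn_linear _ _ _ _ _ LL oU cL).
Qed.

Lemma smooth_affr W X (U' : set W) (f : W -> X) (L : V -> W) (c : W) :
  linear L -> continuous L -> (forall x, U x -> U' (L x + c)) ->
  smooth_on U' f -> smooth_on U (fun x => f (L x + c)).
Proof.
move=> linL cL UU sf k.
pose LM := GRing.isLinear.Build _ _ _ _ _ linL.
pose LL : {linear V -> W} := HB.pack L LM.
exact: (@Cn_affr _ _ _ _ _ _ _ _ LL _ oU cL UU (sf k)).
Qed.

Lemma smoothD W (f g : V -> W) : smooth_on U f -> smooth_on U g ->
  smooth_on U (fun x => f x + g x).
Proof. by move=> sf sg k; exact: CnD. Qed.

Lemma smooth_sum W I (r : seq I) (P : pred I) (F : I -> V -> W) :
  (forall i, smooth_on U (F i)) ->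
  smooth_on U (fun x => \sum_(i <- r | P i) F i x).
Proof.
move=> sF; elim: r => [|i r IH].
  apply: smooth_ext (smooth_cst (0 : W)) => x _; by rewrite big_nil.
case: (boolP (P i)) => Pi.
  apply: smooth_ext (smoothD (sF i) IH) => x _; by rewrite big_cons Pi.
apply: smooth_ext IH => x _; by rewrite big_cons (negbTE Pi).
Qed.

Lemma smoothM (f g : V -> R) : smooth_on U f -> smooth_on U g ->
  smooth_on U (fun x => f x * g x).
Proof. by move=> sf sg k; exact: CnM. Qed.

Lemma smooth_prod I (r : seq I) (F : I -> V -> R) :
  (forall i, smooth_on U (F i)) -> smooth_on U (fun x => \prod_(i <- r) F i x).
Proof.
move=> sF; elim: r => [|i r IH].
  apply: smooth_ext (smooth_cst (1 : R)) => x _; by rewrite big_nil.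
apply: smooth_ext (smoothM (sF i) IH) => x _; by rewrite big_cons.
Qed.

Lemma smooth_rsqrt (f : V -> R) : (forall x, U x -> 0 < f x) ->
  smooth_on U f -> smooth_on U (fun x => (Num.sqrt (f x))^-1).
Proof. by move=> f0 sf k; exact: Cn_rsqrt. Qed.

Lemma smooth_coord n (f : V -> 'rV[R]_n) j :
  smooth_on U f -> smooth_on U (fun x => f x 0 j).
Proof.
apply: (@smooth_linl _ _ f (fun M : 'rV[R]_n => M 0 j)).
  by move=> c u v; rewrite !mxE.
exact: coord_continuous.
Qed.

Lemma smooth_row n (f : V -> 'rV[R]_n) :
  (forall j, smooth_on U (fun x => f x 0 j)) -> smooth_on U f.
Proof.
move=> sf.
have H j : smooth_on U (fun x => f x 0 j *: delta_mx 0 j : 'rV[R]_n).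
  apply: (@smooth_linl _ _ _ (fun t : R => t *: delta_mx 0 j : 'rV[R]_n)) (sf j).
    by move=> c u v; rewrite scalerDl scalerA.
  exact: scalel_continuous.
apply: smooth_ext (smooth_sum (index_enum _) predT H) => x _.
by rewrite -row_sum_delta.
Qed.

Lemma smooth_fst W X (f : V -> W * X) :
  smooth_on U f -> smooth_on U (fun x => (f x).1).
Proof.
apply: (@smooth_linl _ _ f fst) => //.
by move=> x; exact: cvg_fst.
Qed.

Lemma smooth_snd W X (f : V -> W * X) :
  smooth_on U f -> smooth_on U (fun x => (f x).2).
Proof.
apply: (@smooth_linl _ _ f snd) => //.
by move=> x; exact: cvg_snd.
Qed.

Lemma smooth_pair W X (f : V -> W) (g : V -> X) :
  smooth_on U f -> smooth_on U g -> smooth_on U (fun x => (f x, g x)).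
Proof.
move=> sf sg.
have Hf : smooth_on U (fun x => (f x, 0 : X)).
  apply: (@smooth_linl _ _ f (fun w => (w, 0 : X))) sf.
    exact: pair0_linear.
  exact: pair0_continuous.
have Hg : smooth_on U (fun x => (0 : W, g x)).
  apply: (@smooth_linl _ _ g (fun w => (0 : W, w))) sg.
    by move=> c u v; congr (_, _); rewrite /= scaler0 addr0.
  by move=> x; apply: cvg_pair; [exact: cvg_cst|exact: cvg_id].
apply: smooth_ext (smoothD Hf Hg) => x _.
by congr (_, _); rewrite /= ?addr0 ?add0r.
Qed.

(** Entrywise, so that products, blocks and determinants reduce to sums and products of real
    functions. *)
Definition smooth_mx m n (A : V -> 'M[R]_(m, n)) :=
  forall i j, smooth_on U (fun x => A x i j).

Lemma smooth_row_coord n (f : V -> 'rV[R]_n) : smooth_on U f -> smooth_mx f.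
Proof. by move=> sf i j; rewrite ord1; exact: smooth_coord. Qed.

Lemma smooth_mulmx m n p (A : V -> 'M[R]_(m, n)) (B : V -> 'M[R]_(n, p)) :
  smooth_mx A -> smooth_mx B -> smooth_mx (fun x => A x *m B x).
Proof.
move=> sA sB i j.
have H k : smooth_on U (fun x => A x i k * B x k j) by exact: smoothM.
apply: smooth_ext (smooth_sum (index_enum _) predT H) => x _.
by rewrite mxE.
Qed.

Lemma smooth_trmx m n (A : V -> 'M[R]_(m, n)) :
  smooth_mx A -> smooth_mx (fun x => (A x)^T).
Proof. by move=> sA i j; apply: smooth_ext (sA j i) => x _; rewrite mxE. Qed.

Lemma smooth_scalemx m n (f : V -> R) (A : V -> 'M[R]_(m, n)) :
  smooth_on U f -> smooth_mx A -> smooth_mx (fun x => f x *: A x).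
Proof.
move=> sf sA i j.
by apply: smooth_ext (smoothM sf (sA i j)) => x _; rewrite mxE.
Qed.

Lemma smooth_addmx m n (A B : V -> 'M[R]_(m, n)) :
  smooth_mx A -> smooth_mx B -> smooth_mx (fun x => A x + B x).
Proof.
move=> sA sB i j.
by apply: smooth_ext (smoothD (sA i j) (sB i j)) => x _; rewrite mxE.
Qed.

Lemma smooth_cstmx m n (A : 'M[R]_(m, n)) : smooth_mx (fun=> A).
Proof. by move=> i j; exact: smooth_cst. Qed.

Lemma smooth_col_mx m1 m2 n (A : V -> 'M[R]_(m1, n)) (B : V -> 'M[R]_(m2, n)) :
  smooth_mx A -> smooth_mx B -> smooth_mx (fun x => col_mx (A x) (B x)).
Proof.
move=> sA sB i j; case: (splitP i) => k ik.
  have -> : i = lshift _ k by exact: val_inj.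
  by apply: smooth_ext (sA k j) => x _; rewrite col_mxEu.
have -> : i = rshift _ k by exact: val_inj.
by apply: smooth_ext (sB k j) => x _; rewrite col_mxEd.
Qed.

Lemma smooth_row_mx m n1 n2 (A : V -> 'M[R]_(m, n1)) (B : V -> 'M[R]_(m, n2)) :
  smooth_mx A -> smooth_mx B -> smooth_mx (fun x => row_mx (A x) (B x)).
Proof.
move=> /smooth_trmx sA /smooth_trmx sB i j.
apply: smooth_ext (smooth_trmx (smooth_col_mx sA sB) i j) => x _.
by rewrite tr_col_mx !trmxK.
Qed.

Lemma smooth_det n (A : V -> 'M[R]_n) :
  smooth_mx A -> smooth_on U (fun x => \det (A x)).
Proof.
move=> sA; rewrite /determinant; apply: smooth_sum => s.
apply: smoothM; first exact: smooth_cst.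
by apply: smooth_prod => i; exact: sA.
Qed.

End Smooth.

Lemma open_setXT (V W : topologicalType) (U : set V) :
  open U -> open (U `*` (setT : set W)).
Proof.
move=> oU; have -> : U `*` (setT : set W) = fst @^-1` U.
  by apply/seteqP; split=> [z []|z].
by apply: open_comp oU => z _; exact: cvg_fst.
Qed.

Lemma smooth_comp_fst (R : realType) (V W X : normedModType R) (U : set V)
    (f : V -> X) : open U -> smooth_on U f ->
  smooth_on (U `*` (setT : set W)) (fun z => f z.1).
Proof.
move=> oU sf.
have oUT : open (U `*` (setT : set W)) by exact: open_setXT.
have UU (z : V * W) : (U `*` setT) z -> U (z.1 + 0) by rewrite addr0 => -[].
have fst_lin : linear (fst : V * W -> V) by [].
have fst_cont : continuous (fst : V * W -> V) by move=> z; exact: cvg_fst.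
apply: smooth_ext (smooth_affr oUT fst_lin fst_cont UU sf) => // z _.
by rewrite addr0.
Qed.

(** * Positive definite matrices *)

Lemma sqr_norm_row (R : realType) n (w : 'rV[R]_n) :
  (w *m w^T) 0 0 = \sum_i w 0 i ^+ 2.
Proof. by rewrite mxE; apply: eq_bigr => i _; rewrite mxE expr2. Qed.

Lemma sqr_norm_ge0 (R : realType) n (w : 'rV[R]_n) : 0 <= (w *m w^T) 0 0.
Proof. by rewrite sqr_norm_row sumr_ge0 // => i _; exact: sqr_ge0. Qed.

Lemma sqr_norm_eq0 (R : realType) n (w : 'rV[R]_n) :
  (w *m w^T) 0 0 = 0 -> w = 0.
Proof.
rewrite sqr_norm_row => /eqP; rewrite psumr_eq0 => [/allP H|i _].
  apply/rowP => i; have := H i (mem_index_enum _).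
  by rewrite sqrf_eq0 mxE => /eqP.
exact: sqr_ge0.
Qed.

Section PosDef.
Variable R : realType.

Definition posdef n (G : 'M[R]_n) :=
  G^T = G /\ forall u : 'rV_n, u != 0 -> 0 < (u *m G *m u^T) 0 0.

Lemma posdef_unitmx n (G : 'M[R]_n) : posdef G -> G \in unitmx.
Proof.
move=> [_ G0]; rewrite -row_free_unit -kermx_eq0; apply/rowV0P => u /sub_kermxP uG.
by apply/eqP/negP => /negP /G0; rewrite uG mul0mx mxE ltxx.
Qed.

(** The Schur complement of the pivot. Its inverse is written [r * r], so that the inverse square
    root stays the only non-polynomial operation. *)
Definition schur n (G : 'M[R]_(1 + n)) : 'M[R]_n :=
  let r := (Num.sqrt (G 0 0))^-1 in
  drsubmx G - (r * r) *: ((ursubmx G)^T *m ursubmx G).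

(* A lower triangular [C] with [C *m G *m C^T = 1], by block elimination. *)
Fixpoint inv_cholesky n : 'M[R]_n -> 'M[R]_n :=
  if n is n'.+1 then fun G : 'M[R]_(1 + n') =>
    let r := (Num.sqrt (G 0 0))^-1 in
    let C := inv_cholesky (schur G) in
    block_mx (r%:M : 'M[R]_1) 0 (- (r * r) *: (C *m (ursubmx G)^T)) C
  else fun=> 0.

Section Step.
Variables (n : nat) (G : 'M[R]_(1 + n)).
Hypothesis pG : posdef G.
Let r := (Num.sqrt (G 0 0))^-1.
Let b := ursubmx G.

Lemma posdef_pivot : 0 < G 0 0.
Proof.
have [_ /(_ (delta_mx 0 0))] := pG.
rewrite -rowE trmx_delta -colE !mxE; apply.
by apply/eqP => /matrixP /(_ 0 0) /eqP; rewrite !mxE !eqxx /= oner_eq0.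
Qed.

Lemma rsqrt_pivot : r * r * G 0 0 = 1.
Proof.
have a0 := posdef_pivot.
rewrite /r -invfM -expr2 sqr_sqrtr ?ltW // mulVf //; exact: lt0r_neq0.
Qed.

Lemma posdef_block : G = block_mx (G 0 0)%:M b b^T (drsubmx G).
Proof.
have [sG _] := pG.
rewrite -[LHS]submxK; congr block_mx.
  by apply/matrixP => i j; rewrite !ord1 !mxE eqxx mulr1n; congr (G _ _); apply: val_inj.
by rewrite /b trmx_ursub sG.
Qed.

Lemma posdef_schur : posdef (schur G).
Proof.
have [sG G0] := pG; split.
  by rewrite /schur raddfB /= linearZ /= trmx_mul trmxK trmx_drsub sG.
(* This [x] kills the first coordinate of [row_mx x u *m G], so the form of [G] at [(x, u)] equals
   the form of the Schur complement at [u]. *)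
move=> u u0; set x : 'rV[R]_1 := - (r * r) *: (u *m b^T).
have : row_mx x u != 0.
  by apply: contraNN u0 => /eqP; rewrite -row_mx0 => /eq_row_mx [_ ->].
move=> /G0; rewrite [X in _ *m X *m _]posdef_block mul_row_block tr_row_mx.
rewrite mul_row_col mul_mx_scalar /x scalerA mulrN [G 0 0 * _]mulrC rsqrt_pivot.
rewrite scaleN1r addNr mul0mx add0r.
congr (_ < (_ *m _) _ _).
by rewrite /schur mulmxBr addrC -scalemxAl -scalemxAr scaleNr mulmxA.
Qed.

End Step.

(** The lower left block of [B] is the one that clears the lower left block of [B *m G], leaving [C]
    times the Schur complement in the lower right; multiplying by [B^T] then clears the upper right
    block too. *)
Lemma block_congruence n (r a : R) (b : 'rV[R]_n) (C D : 'M[R]_n) :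
  r * r * a = 1 -> C *m (D - (r * r) *: (b^T *m b)) *m C^T = 1%:M ->
  let B := block_mx (r%:M : 'M[R]_1) 0 (- (r * r) *: (C *m b^T)) C in
  B *m block_mx a%:M b b^T D *m B^T = 1%:M.
Proof.
move=> ra EC B; rewrite /B.
rewrite mulmx_block !mul0mx !addr0 -scalar_mxM mul_scalar_mx.
rewrite mul_mx_scalar scalerA mulrN [a * _]mulrC ra scaleN1r addNr.
rewrite tr_block_mx mulmx_block !mul0mx !add0r tr_scalar_mx trmx0 !mulmx0 !addr0.
rewrite -scalar_mxM [r * a * r]mulrAC ra.
rewrite linearZ /= trmx_mul trmxK mul_scalar_mx scalerA -scalemxAl.
rewrite mulrN [r * a * _]mulrC mulrA [r * r * r * a]mulrAC ra mul1r scaleNr addNr.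
rewrite (_ : _ + C *m D = C *m (D - (r * r) *: (b^T *m b))).
  by rewrite EC -scalar_mx_block.
by rewrite mulmxBr addrC -scalemxAl -scalemxAr scaleNr mulmxA.
Qed.

Lemma inv_choleskyP n (G : 'M[R]_n) : posdef G ->
  inv_cholesky G *m G *m (inv_cholesky G)^T = 1%:M.
Proof.
elim: n G => [|n IH] G pG; first by apply/matrixP => -[].
rewrite [X in _ *m X *m _](posdef_block pG).
exact: block_congruence (rsqrt_pivot pG) (IH _ (posdef_schur pG)).
Qed.

Lemma smooth_inv_cholesky (V : normedModType R) (U : set V) n (G : V -> 'M[R]_n) :
  open U -> (forall x, U x -> posdef (G x)) -> smooth_mx U G ->
  smooth_mx U (fun x => inv_cholesky (G x)).
Proof.
move=> oU; elim: n G => [|n IH] G pG sG; first by case.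
have sr : smooth_on U (fun x => (Num.sqrt ((G x) 0 0))^-1).
  by apply: smooth_rsqrt => // x /pG; exact: (@posdef_pivot n).
have sr2 := smoothM oU sr sr.
have sb : smooth_mx U (fun x => ursubmx (G x : 'M[R]_(1 + n))).
  by move=> i j; apply: smooth_ext (sG (lshift n i) (rshift 1 j)) => // x _; rewrite !mxE.
have sD : smooth_mx U (fun x => drsubmx (G x : 'M[R]_(1 + n))).
  by move=> i j; apply: smooth_ext (sG (rshift 1 i) (rshift 1 j)) => // x _; rewrite !mxE.
have sN m p (f : V -> R) (A : V -> 'M[R]_(m, p)) : smooth_on U f ->
    smooth_mx U A -> smooth_mx U (fun x => - f x *: A x).
  move=> sf; apply: smooth_scalemx => //.
  apply: smooth_ext (smoothM oU (smooth_cst U (-1 : R)) sf) => // x _.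
  by rewrite mulN1r.
have sS : smooth_mx U (fun x => schur (G x : 'M[R]_(1 + n))).
  have sbb := smooth_mulmx oU (smooth_trmx oU sb) sb.
  have H := smooth_addmx oU sD (sN _ _ _ _ sr2 sbb).
  move=> i j; apply: smooth_ext (H i j) => // x _.
  by rewrite scaleNr.
have sC := IH _ (fun x Ux => @posdef_schur n _ (pG x Ux)) sS.
suff H : smooth_mx U (fun x => let r := (Num.sqrt (G x 0 0))^-1 in
    let C := inv_cholesky (schur (G x : 'M[R]_(1 + n))) in
    block_mx (r%:M : 'M[R]_1) 0
      (- (r * r) *: (C *m (ursubmx (G x : 'M[R]_(1 + n)))^T)) C).
  exact: H.
apply: smooth_col_mx => //; apply: smooth_row_mx => //.
- move=> i j; rewrite !ord1; apply: smooth_ext sr => // x _.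
  by rewrite mxE eqxx mulr1n.
- exact: smooth_cstmx.
- by apply: sN => //; apply: smooth_mulmx => //; exact: smooth_trmx.
Qed.

End PosDef.

(** * Generalized cross product of [d] vectors in dimension [d + 1] *)

Section Cross.
Variable R : realType.
Implicit Type d : nat.

Definition cross d (A : 'M[R]_(d, d.+1)) : 'rV[R]_d.+1 :=
  \row_j \det (col_mx (delta_mx 0 j) A : 'M[R]_(1 + d)).

(** Laplace expansion along the first row: its cofactors do not involve [w], and taking basis
    vectors for [w] shows that they are the coordinates of [cross A]. *)
Lemma det_col_cross d (w : 'rV[R]_d.+1) (A : 'M[R]_(d, d.+1)) :
  \det (col_mx w A : 'M[R]_(1 + d)) = (w *m (cross A)^T) 0 0.
Proof.
have col0E (u : 'rV[R]_d.+1) j : (col_mx u A : 'M[R]_d.+1) 0 j = u 0 j.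
  rewrite -(col_mxEu u A).
  by congr (fun_of_matrix (col_mx u A : 'M[R]_d.+1) _ _); exact: val_inj.
have cofE (u : 'rV[R]_d.+1) j :
    cofactor (col_mx u A : 'M[R]_(1 + d)) 0 j = cofactor (col_mx 0 A : 'M[R]_(1 + d)) 0 j.
  rewrite /cofactor; congr (_ * \det _); apply/matrixP => i k; rewrite !mxE.
  by case: splitP => // l; rewrite !ord1.
have crE j : cross A 0 j = cofactor (col_mx 0 A : 'M[R]_(1 + d)) 0 j.
  rewrite mxE (expand_det_row _ 0) (bigD1 j) //= big1 => [|k kj].
    by rewrite addr0 cofE col0E mxE !eqxx mul1r.
  by rewrite col0E mxE (negbTE kj) andbF mul0r.
rewrite (expand_det_row _ 0) mxE; apply: eq_bigr => j _.
by rewrite cofE -crE [in RHS]mxE col0E.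
Qed.

(** Pairing row [i] of [A] with [cross A] gives a determinant in which that row occurs twice. *)
Lemma cross_orthogonal d (A : 'M[R]_(d, d.+1)) : A *m (cross A)^T = 0.
Proof.
apply/row_matrixP => i; rewrite row_mul row0; apply/matrixP => k j.
rewrite !ord1 -det_col_cross mxE.
apply: (@determinant_alternate _ _ _ (lshift d (0 : 'I_1)) (rshift 1 i)) => // l.
by rewrite col_mxEu col_mxEd mxE.
Qed.

(** Left multiplication by the block diagonal matrix of [1] and [J] fixes the first row and turns
    [A] into [J *m A]. This is how orientation enters: [J] will be a transition Jacobian. *)
Lemma cross_mull d (J : 'M[R]_d) (A : 'M[R]_(d, d.+1)) :
  cross (J *m A) = \det J *: cross A.
Proof.
apply/rowP => j; rewrite !mxE.
rewrite -[in RHS](mul1r (\det J)) -[in RHS](det1 R 1).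
rewrite -(@det_ublock _ 1 d 1%:M 0 J) -det_mulmx; congr (\det _).
by rewrite mul_block_col !mul0mx addr0 add0r mul1mx.
Qed.

(** For dimension reasons some [w != 0] is orthogonal to the rows of [A]. The square of the
    determinant of [w] stacked on [A] is then [|w|^2 det (A A^T)], which is nonzero, whereas
    [cross A = 0] would make that determinant vanish. *)
Lemma cross_neq0 d (A : 'M[R]_(d, d.+1)) : posdef (A *m A^T) -> cross A != 0.
Proof.
move=> /posdef_unitmx uAA.
have : kermx A^T != 0.
  rewrite kermx_eq0 -row_leq_rank -ltnNge ltnS mxrank_tr; exact: rank_leq_row.
move=> /rowV0Pn [w /sub_kermxP wA w0].
apply: contraTneq uAA => c0.
have /eqP : \det (col_mx w A : 'M[R]_(1 + d)) = 0.
  by rewrite det_col_cross c0 trmx0 mulmx0 mxE.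
rewrite -sqrf_eq0 expr2 -[X in _ * X]det_tr -det_mulmx.
rewrite (@tr_col_mx _ 1 d) (@mul_col_row _ 1 d _ 1 d).
rewrite wA -[A *m w^T]trmxK trmx_mul trmxK wA trmx0 det_ublock mulf_eq0.
rewrite det_mx11 unitmxE unitfE => /orP[/eqP ww|/eqP -> //]; last by rewrite eqxx.
by case/eqP: w0; exact: sqr_norm_eq0.
Qed.

End Cross.

(** * Charts, tangent vectors and the metric *)

Section Charts.
Variables (R : realType) (d : nat) (M : smooth_manifold R d).
Implicit Types (a b c : chart R M d) (p : M).

Lemma chart_invK a x : chart_image a x ->
  chart_dom a (chart_inv a x) /\ chart_map a (chart_inv a x) = x.
Proof. by move=> [p ap <-]; rewrite chart_mapK. Qed.

Lemma chart_image_map a p : chart_dom a p -> chart_image a (chart_map a p).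
Proof. by move=> ap; exists p. Qed.

Lemma chart_at_inv a x : atlas a -> chart_image a x -> chart_at (chart_inv a x) a.
Proof. by move=> aa /chart_invK[]. Qed.

Definition overlap a b : set 'rV[R]_d := chart_map a @` (chart_dom a `&` chart_dom b).

Lemma overlapP a b x :
  overlap a b x <-> chart_image a x /\ chart_dom b (chart_inv a x).
Proof.
split=> [[p [ap bp] <-]|[ax bx]].
  by split; [exact: chart_image_map|rewrite chart_mapK].
by have [ap xE] := chart_invK ax; exists (chart_inv a x).
Qed.

Lemma open_overlap a b : open (overlap a b).
Proof.
rewrite openE => x /overlapP[ax bx].
have H1 : \near x, chart_image a x.
  exact: open_nbhs_nbhs (conj (@chart_image_open _ _ _ a) ax).
have H2 : \near x, chart_dom b (chart_inv a x).
  apply: (chart_inv_continuous ax).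
  exact: open_nbhs_nbhs (conj (chart_dom_open b) bx).
by apply: filterS2 H1 H2 => y ay by_; exact/overlapP.
Qed.

Lemma transition_smooth a b : atlas a -> atlas b ->
  smooth_on (overlap a b) (transition a b).
Proof. by move=> aa ab; have [] := atlas_compatible aa ab. Qed.

Lemma transition_differentiable a b x : atlas a -> atlas b ->
  overlap a b x -> differentiable (transition a b) x.
Proof. by move=> aa ab; have [+ _] := transition_smooth aa ab 1%N; exact. Qed.

Lemma near_overlap a b x : overlap a b x -> \near x, overlap a b x.
Proof. by move=> abx; apply: open_nbhs_nbhs; split=> //; exact: open_overlap. Qed.

Lemma mulmx_transition_jacobian p a b u :
  u *m transition_jacobian p a b = 'd (transition a b) (chart_map a p) u.
Proof. exact: mul_rV_lin1. Qed.

(** [transition a a] is known to be the identity only on the image of [a], which is a neighbourhood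
    of the point. *)
Lemma transition_jacobian_id p a : atlas a -> chart_dom a p ->
  transition_jacobian p a a = 1%:M.
Proof.
move=> aa ap; apply/row_matrixP => i; rewrite !rowE mulmx1.
rewrite mulmx_transition_jacobian.
have nE : \forall x \near chart_map a p, id x = transition a a x.
  have H : overlap a a (chart_map a p) by exists p.
  by apply: filterS (near_overlap H) => x /overlapP[/chart_invK[]].
have [-> _] := near_eq_differentiable nE (ex_diff (is_diff_def := is_diff_id _)).
by rewrite (diff_val (is_diff_def := is_diff_id _)).
Qed.

(** The chain rule, applied to a composite that agrees with [transition a c] only on the overlap of
    [a] and [b]. The order of the factors reflects the action on row vectors. *)
Lemma transition_jacobian_comp p a b c : chart_at p a -> chart_at p b ->
  chart_at p c ->
  transition_jacobian p a c = transition_jacobian p a b *m transition_jacobian p b c.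
Proof.
move=> [aa ap] [ab bp] [ac cp]; apply/row_matrixP => i.
rewrite !rowE mulmxA; move: (delta_mx 0 i) => u.
have abp : overlap a b (chart_map a p) by exists p.
have bcp : overlap b c (chart_map b p) by exists p.
have Ep : transition a b (chart_map a p) = chart_map b p.
  by rewrite /transition /= chart_mapK.
have nE : \forall x \near chart_map a p,
    (transition b c \o transition a b) x = transition a c x.
  apply: filterS (near_overlap abp) => x /overlapP[ax bx].
  by rewrite /transition /= chart_mapK.
have dab := transition_differentiable aa ab abp.
have dbc : differentiable (transition b c) (transition a b (chart_map a p)).
  by rewrite Ep; exact: transition_differentiable.
have [Eac _] := near_eq_differentiable nE (differentiable_comp dab dbc).
apply: etrans (mulmx_transition_jacobian p a c u) _.
apply: etrans (congr1 (fun F => F u) (etrans Eac (diff_comp dab dbc))) _.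
rewrite [LHS]/= Ep; apply: esym.
apply: etrans (mulmx_transition_jacobian p b c _) _.
exact: congr1 (mulmx_transition_jacobian p a b u).
Qed.

Lemma det_transition_jacobian_smooth a b : atlas a -> atlas b ->
  smooth_on (overlap a b) (fun x => \det (transition_jacobian (chart_inv a x) a b)).
Proof.
move=> aa ab; apply: smooth_det; first exact: open_overlap.
move=> i j k.
have [df _] := transition_smooth aa ab 1%N.
have oo := @open_overlap a b.
(* Row [i] of the Jacobian is this directional derivative; its order [m] is read off order [m.+1] of
   the transition map. *)
have H : smooth_on (overlap a b) ('D_(delta_mx 0 i) (transition a b)).
  by move=> m; have [_ /(_ (delta_mx 0 i))] := transition_smooth aa ab m.+1.
apply: (smooth_ext oo) (smooth_coord oo j H) k => x /set_mem abx.
rewrite deriveEjacobian; last exact: df.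
have [ax _] := (overlapP _ _ _).1 abx.
by rewrite -rowE mxE /transition_jacobian (chart_invK ax).2.
Qed.

(* Otherwise a failing unification of two Jacobians unfolds the differentials
   and does not terminate. *)
#[local] Opaque transition_jacobian.

Lemma transition_jacobianK p a b : chart_at p a -> chart_at p b ->
  transition_jacobian p a b *m transition_jacobian p b a = 1%:M.
Proof.
move=> ap bp; rewrite -transition_jacobian_comp // transition_jacobian_id //.
  by case: ap.
by case: ap.
Qed.

Lemma det_transition_jacobian_neq0 p a b : chart_at p a -> chart_at p b ->
  \det (transition_jacobian p a b) != 0.
Proof.
move=> ap bp; rewrite -unitfE -unitmxE.
exact: (mulmx1_unit (transition_jacobianK ap bp)).1.
Qed.

Section TangentSpace.
Variable p : M.

Lemma tangentZD (k : R) u v : tangent p u -> tangent p v -> tangent p (k *: u + v).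
Proof.
move=> [u0 uJ] [v0 vJ]; split=> [a na|a b pa pb]; rewrite !fctE.
  by rewrite u0 // v0 // scaler0 addr0.
by rewrite (uJ a b) // (vJ a b) // mulmxDl scalemxAl.
Qed.

Lemma tangent0 : tangent p (0 : chart R M d -> 'rV[R]_d).
Proof. by split=> // a b _ _; rewrite mul0mx. Qed.

Lemma tangent_sum I (r : seq I) (k : I -> R) (v : I -> chart R M d -> 'rV[R]_d) :
  (forall i, tangent p (v i)) -> tangent p (\sum_(i <- r) k i *: v i).
Proof.
move=> tv; elim: r => [|i r IH]; first by rewrite big_nil; exact: tangent0.
by rewrite big_cons; exact: tangentZD.
Qed.

Lemma tangent_inj a u v : chart_at p a -> tangent p u -> tangent p v ->
  u a = v a -> u = v.
Proof.
move=> pa [u0 uJ] [v0 vJ] E; apply/funext => b.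
have [pb|npb] := pselect (chart_at p b); last by rewrite u0 // v0.
by rewrite (uJ a b) // (vJ a b) // E.
Qed.

Lemma tangent_vectorE a u : chart_at p a -> tangent_vector a p u a = u.
Proof.
move=> pa; rewrite /tangent_vector asboolT //.
by rewrite transition_jacobian_id ?mulmx1 //; case: pa.
Qed.

Lemma tangent_vector_tangent a u : chart_at p a -> tangent p (tangent_vector a p u).
Proof.
move=> pa; split=> [b npb|b c pb pc].
  by rewrite /tangent_vector (asboolF npb).
rewrite /tangent_vector (asboolT pb) (asboolT pc).
by rewrite (transition_jacobian_comp pa pb pc) mulmxA.
Qed.

End TangentSpace.

Section Metric.
Variable g : riemannian_metric M.

Section Pointwise.
Variable p : M.

Lemma metric0 w : tangent p w -> g p 0 w = 0.
Proof.
move=> tw; have := metric_linear g 1 (tangent0 p) (tangent0 p) tw.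
by rewrite scaler0 addr0 mul1r => /eqP; rewrite -subr_eq0 opprD addNKr oppr_eq0 => /eqP.
Qed.

Lemma metric_suml I (r : seq I) (k : I -> R) (v : I -> chart R M d -> 'rV[R]_d) w :
  (forall i, tangent p (v i)) -> tangent p w ->
  g p (\sum_(i <- r) k i *: v i) w = \sum_(i <- r) k i * g p (v i) w.
Proof.
move=> tv tw; elim: r => [|i r IH]; first by rewrite !big_nil metric0.
by rewrite !big_cons metric_linear // ?IH //; exact: tangent_sum.
Qed.

Definition gram a : 'M[R]_d := \matrix_(i, j)
  g p (tangent_vector a p (delta_mx 0 i)) (tangent_vector a p (delta_mx 0 j)).

Lemma metricE a u v : chart_at p a -> tangent p u -> tangent p v ->
  g p u v = (u a *m gram a *m (v a)^T) 0 0.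
Proof.
move=> pa.
have E w : tangent p w ->
    w = \sum_i w a 0 i *: tangent_vector a p (delta_mx 0 i).
  move=> tw; apply: (tangent_inj pa) => //.
    by apply: tangent_sum => i; exact: tangent_vector_tangent.
  rewrite fct_sumE [LHS]row_sum_delta; apply: eq_bigr => i _.
  by rewrite !fctE tangent_vectorE.
have tt i := tangent_vector_tangent (delta_mx 0 i) pa.
move=> tu tv; rewrite {1}[u]E // metric_suml // -mulmxA mxE.
apply: eq_bigr => i _; congr (_ * _).
(* Linearity is given in the first argument; symmetry carries it to the second. *)
rewrite Defs.metric_sym // {1}[v]E // metric_suml // mxE; apply: eq_bigr => j _.
by rewrite !mxE mulrC Defs.metric_sym.
Qed.

Lemma gram_posdef a : chart_at p a -> posdef (gram a).
Proof.
move=> pa; split=> [|u u0].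
  apply/matrixP => i j; rewrite !mxE Defs.metric_sym //; exact: tangent_vector_tangent.
have tu := tangent_vector_tangent u pa.
have := metricE pa tu tu; rewrite (tangent_vectorE u pa) => <-.
apply: metric_pos => // E.
by case/eqP: u0; rewrite -(tangent_vectorE u pa) E.
Qed.

End Pointwise.

Lemma gram_smooth a : atlas a ->
  smooth_mx (chart_image a) (fun x => gram (chart_inv a x) a).
Proof.
move=> aa i j.
apply: smooth_ext (@metric_smooth _ _ _ g _ aa (delta_mx 0 i) (delta_mx 0 j)).
  exact: chart_image_open.
by move=> x _; rewrite mxE.
Qed.

End Metric.
End Charts.

(** * From a stable trivialization to a Parseval frame *)

Section Forward.
Variables (R : realType) (d : nat) (M : smooth_manifold R d).
Variable g : riemannian_metric M.
Implicit Types (a b c : chart R M d) (p : M).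
Variables (Phi : M -> (chart R M d -> 'rV[R]_d) * R -> 'rV[R]_d.+1)
  (Psi : M -> 'rV[R]_d.+1 -> (chart R M d -> 'rV[R]_d) * R).
Hypothesis triv : stable_trivialization Phi Psi.

Let e i p := Psi p (delta_mx 0 i).

Lemma frame_tangent i p : tangent p (e i p).1.
Proof. by have [_ /(_ p (delta_mx 0 i)) [[]]] := triv. Qed.

Lemma trivialization0 p : Phi p (0, 0) = 0.
Proof.
have [linP _ _ _ _] := triv.
have s0 : stable_fiber p (0 : chart R M d -> 'rV[R]_d, 0 : R).
  by split=> //; exact: tangent0.
have := linP p 1 (0, 0) (0, 0) s0 s0.
rewrite /= scaler0 mulr0 !addr0 scale1r => /eqP.
by rewrite -subr_eq0 opprD addNKr oppr_eq0 => /eqP.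
Qed.

Lemma trivialization_sum p I (r : seq I) (k : I -> R)
    (v : I -> (chart R M d -> 'rV[R]_d)) (t : I -> R) :
  (forall i, tangent p (v i)) ->
  Phi p (\sum_(i <- r) k i *: v i, \sum_(i <- r) k i * t i) =
  \sum_(i <- r) k i *: Phi p (v i, t i).
Proof.
have [linP _ _ _ _] := triv.
have st v' t' : tangent p v' -> stable_fiber p (v', t') by [].
move=> tv; elim: r => [|i r IH].
  by rewrite !big_nil trivialization0.
rewrite !big_cons -IH.
exact: (linP p (k i) (v i, t i) (_, _) (st _ _ (tv i)) (st _ _ (tangent_sum _ _ tv))).
Qed.

(** [Psi p] inherits linearity from its inverse [Phi p]: both sides have the same image under
    [Phi p]. *)
Lemma trivialization_invE p w :
  Psi p w = (\sum_i w 0 i *: (e i p).1, \sum_i w 0 i * (e i p).2).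
Proof.
have [linP PK KP _ _] := triv.
rewrite -[RHS](KP p) //; last first.
  by split=> //; apply: tangent_sum => i; exact: frame_tangent.
congr (Psi p _); rewrite trivialization_sum => [|i]; last exact: frame_tangent.
rewrite [LHS]row_sum_delta; apply: eq_bigr => i _.
by rewrite -surjective_pairing (PK p _).2.
Qed.

Definition frame_mx a p : 'M[R]_(d.+1, d) := \matrix_i (e i p).1 a.
Definition frame_col p : 'cV[R]_d.+1 := \col_i (e i p).2.

Lemma trivialization_inv1 a p w : (Psi p w).1 a = w *m frame_mx a p.
Proof.
rewrite trivialization_invE /= fct_sumE mulmx_sum_row; apply: eq_bigr => i _.
by rewrite rowK.
Qed.

Lemma trivialization_inv2 p w : (Psi p w).2 = (w *m frame_col p) 0 0.
Proof.
by rewrite trivialization_invE /= mxE; apply: eq_bigr => i _; rewrite mxE.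
Qed.

Definition stable_gram p : 'M[R]_d.+1 :=
  \matrix_(i, k) (g p (e i p).1 (e k p).1 + (e i p).2 * (e k p).2).

(** The left side does not depend on a chart; this form in a given chart is what yields positivity
    and smoothness. *)
Lemma stable_gramE a p : chart_at p a ->
  stable_gram p = frame_mx a p *m gram g p a *m (frame_mx a p)^T +
                  frame_col p *m (frame_col p)^T.
Proof.
move=> pa; apply/matrixP => i k; rewrite !mxE.
congr (_ + _); last by rewrite big_ord1 !mxE.
rewrite (metricE _ pa) ?mxE; [|exact: frame_tangent..].
apply: eq_bigr => j _; rewrite !mxE; congr (_ * _).
by apply: eq_bigr => l _; rewrite !mxE.
Qed.

(** The form at [w] is the squared length of [Psi p w] for the metric [g + dt^2]. If it vanishes, so
    do both components of [Psi p w], and applying [Phi p] gives [w = 0]. *)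
Lemma stable_gram_posdef p : posdef (stable_gram p).
Proof.
have [a aa ap] := atlas_cover p.
have pa : chart_at p a by [].
have [linP PK KP _ _] := triv.
have [sgr gr] := gram_posdef g pa.
rewrite (stable_gramE pa); split=> [|w w0].
  by rewrite raddfD /= !trmx_mul !trmxK sgr mulmxA.
rewrite mulmxDr mulmxDl mxE.
set E := frame_mx a p; set T := frame_col p.
have -> : w *m (E *m gram g p a *m E^T) *m w^T =
    (w *m E) *m gram g p a *m (w *m E)^T by rewrite trmx_mul !mulmxA.
have -> : w *m (T *m T^T) *m w^T = (w *m T) *m (w *m T)^T.
  by rewrite trmx_mul !mulmxA.
have T0 := sqr_norm_ge0 (w *m T).
have [E0|E0] := eqVneq (w *m E) 0; last first.
  by rewrite ltr_wpDr // gr.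
rewrite E0 !mul0mx mxE add0r lt0r T0 andbT; apply/eqP => /sqr_norm_eq0 T1.
have PE : Psi p w = (0, 0).
  rewrite [LHS]surjective_pairing trivialization_inv2 T1 mxE; congr (_, _).
  apply: (tangent_inj pa); [exact: (PK p w).1.1|exact: tangent0|].
  by rewrite trivialization_inv1 E0.
case/eqP: w0; by rewrite -(PK p w).2 PE trivialization0.
Qed.

(** The rows of the inverse Cholesky factor combine the frame [e] into an orthonormal basis for
    [g + dt^2]; keeping only the [.1] components projects it orthogonally to the tangent space. *)
Definition parseval_of j p : chart R M d -> 'rV[R]_d :=
  \sum_i inv_cholesky (stable_gram p) j i *: (e i p).1.

Lemma parseval_of_tangent j p : tangent p (parseval_of j p).
Proof. by apply: tangent_sum => i; exact: frame_tangent. Qed.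

Lemma parseval_ofE a j p :
  parseval_of j p a = row j (inv_cholesky (stable_gram p) *m frame_mx a p).
Proof.
rewrite row_mul mulmx_sum_row /parseval_of fct_sumE.
by apply: eq_bigr => i _; rewrite rowK [in RHS]mxE.
Qed.

Lemma frame_mx_smooth a : atlas a ->
  smooth_mx (chart_image a) (fun x => frame_mx a (chart_inv a x)) /\
  smooth_mx (chart_image a) (fun x => frame_col (chart_inv a x)).
Proof.
move=> aa; have oa := @chart_image_open _ _ _ a.
have [_ _ _ _ /(_ a aa) sP] := triv.
have H i : smooth_on (chart_image a)
    (fun x => ((e i (chart_inv a x)).1 a, (e i (chart_inv a x)).2)).
  (* [Psi] is jointly smooth in base point and vector; the affine map
     [x |-> (x, 0) + (0, delta_mx 0 i)] restricts it to a fixed basis vector. *)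
  have LU x : chart_image a x ->
      (chart_image a `*` setT) ((x, 0 : 'rV[R]_d.+1) + (0, delta_mx 0 i)).
    by split=> //=; rewrite addr0.
  have sPL := smooth_affr oa (@pair0_linear _ _ _) (@pair0_continuous _ _ _) LU sP.
  apply: smooth_ext sPL => // x _.
  by rewrite /= addr0 add0r.
split=> i j.
  apply: smooth_ext (smooth_coord oa j (smooth_fst oa (H i))) => // x _.
  by rewrite mxE.
apply: smooth_ext (smooth_snd oa (H i)) => // x _.
by rewrite mxE.
Qed.

Lemma parseval_of_smooth j : smooth_vector_field (parseval_of j).
Proof.
split=> [p|a aa]; first exact: parseval_of_tangent.
have oa := @chart_image_open _ _ _ a.
have [sE sT] := frame_mx_smooth aa.
have sG : smooth_mx (chart_image a) (fun x => stable_gram (chart_inv a x)).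
  have H := smooth_addmx oa
    (smooth_mulmx oa (smooth_mulmx oa sE (gram_smooth g aa)) (smooth_trmx oa sE))
    (smooth_mulmx oa sT (smooth_trmx oa sT)).
  move=> i k; apply: smooth_ext (H i k) => // x /set_mem ax.
  by rewrite (stable_gramE (chart_at_inv aa ax)).
have sC := smooth_inv_cholesky oa (fun x _ => stable_gram_posdef _) sG.
apply: smooth_row => // k.
apply: smooth_ext (smooth_mulmx oa sC sE j k) => // x _.
by rewrite parseval_ofE [RHS]mxE.
Qed.

(** If [w] is the coordinate vector of [(v, 0)] in the frame [e], the inner products of [v] with the
    fields form the row [w G C^T]. Its squared norm [w G C^T C G w^T] is [w G w^T], the squared
    length of [v]. *)
Lemma parseval_of_frame : parseval_frame g parseval_of.
Proof.
split=> [j|p v tv]; first exact: parseval_of_smooth.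
have [a aa ap] := atlas_cover p.
have pa : chart_at p a by [].
have [linP PK KP _ _] := triv.
have [sgr gr] := gram_posdef g pa.
have gv0 : 0 <= g p v v.
  have [->|v0] := pselect (v = 0); first by rewrite (metric0 _ (tangent0 p)).
  exact/ltW/metric_pos.
rewrite /metric_norm sqr_sqrtr //.
have CGC := inv_choleskyP (stable_gram_posdef p).
set C := inv_cholesky _ in CGC *; set G := stable_gram p in CGC.
set E := frame_mx a p; set T := frame_col p.
pose w := Phi p (v, 0).
have PwE : Psi p w = (v, 0) by rewrite /w KP.
have wE : w *m E = v a by rewrite -trivialization_inv1 PwE.
have wT : w *m T = 0.
  by apply/matrixP => i j; rewrite !ord1 -trivialization_inv2 PwE mxE.
have GE : G = E *m gram g p a *m E^T + T *m T^T by exact: stable_gramE.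
(* The zero line component of [(v, 0)] gives [w *m T = 0], which removes the [dt^2] part of [G]. *)
have vE : v a *m gram g p a *m E^T = w *m G.
  by rewrite GE mulmxDr !mulmxA wT mul0mx addr0 wE.
have H : \sum_(j < d.+1) `|g p v (parseval_of j p)| ^+ 2 =
    ((w *m G *m C^T) *m (w *m G *m C^T)^T) 0 0.
  rewrite sqr_norm_row; apply: eq_bigr => j _.
  rewrite real_normK ?num_real //; congr (_ ^+ 2).
  rewrite (metricE g pa tv (parseval_of_tangent _ _)) parseval_ofE -/C -/E.
  by rewrite tr_row trmx_mul -vE colE !mulmxA -colE [LHS]mxE.
have GCC : G *m C^T *m C = 1%:M.
  by apply: mulmx1C; rewrite mulmxA.
have sG : G^T = G by have [] := stable_gram_posdef p.
rewrite H (metricE g pa tv tv) !trmx_mul trmxK sG.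
congr (fun_of_matrix _ _ _).
transitivity (w *m (G *m C^T *m C) *m G *m w^T); first by rewrite !mulmxA.
by rewrite GCC mulmx1 -vE -mulmxA -trmx_mul wE.
Qed.

End Forward.

(** * From a Parseval frame to a stable trivialization *)

(** Polarization: the form at the sum of the basis vectors [i] and [j] reduces to [2 B i j]. *)
Lemma symmetric_form_eq0 (R : realType) n (B : 'M[R]_n) :
  B^T = B -> (forall u : 'rV_n, (u *m B *m u^T) 0 0 = 0) -> B = 0.
Proof.
move=> sB B0.
have E i j : ((delta_mx 0 i : 'rV_n) *m B *m (delta_mx 0 j : 'rV_n)^T) 0 0 = B i j.
  by rewrite -rowE trmx_delta -colE !mxE.
apply/matrixP => i j; rewrite [RHS]mxE.
have Bji : B j i = B i j by rewrite -[in LHS]sB mxE.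
have := B0 (delta_mx 0 i + delta_mx 0 j).
rewrite raddfD /= !mulmxDl !mulmxDr [LHS]mxE [X in X + _]mxE [X in _ + X]mxE.
rewrite !E Bji -[B i i]E -[B j j]E !B0 add0r addr0 => /eqP.
by rewrite -mulr2n mulrn_eq0 => /eqP.
Qed.

Section Normalize.
Variable R : realType.

Definition normalize n (w : 'rV[R]_n) : 'rV[R]_n :=
  (Num.sqrt ((w *m w^T) 0 0))^-1 *: w.

(** With [c] a Jacobian determinant, this reduces the effect of a change of chart on the normal to a
    sign. *)
Lemma normalizeZ n (c : R) (w : 'rV[R]_n) :
  c != 0 -> normalize (c *: w) = Num.sg c *: normalize w.
Proof.
move=> c0; rewrite /normalize [(c *: w)^T]linearZ /= -scalemxAl -scalemxAr !mxE.
rewrite mulrA -expr2 sqrtrM ?sqr_ge0 // sqrtr_sqr invfM !scalerA.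
by rewrite [_ * c]mulrAC [`|c|]normrEsg invfM mulfVK // invr_sg.
Qed.

Lemma normalize_sqr n (w : 'rV[R]_n) :
  w != 0 -> normalize w *m (normalize w)^T = 1%:M.
Proof.
move=> w0; have q0 : (w *m w^T) 0 0 != 0.
  by apply: contraNneq w0 => /sqr_norm_eq0 ->.
apply/matrixP => i j; rewrite !ord1 [RHS]mxE.
rewrite /normalize linearZ /= -scalemxAl -scalemxAr scalerA mxE.
by rewrite -invfM -expr2 sqr_sqrtr ?sqr_norm_ge0 // mulVf.
Qed.

Lemma normalize_smooth (V : normedModType R) (U : set V) n (f : V -> 'rV[R]_n) :
  open U -> (forall x, U x -> f x != 0) -> smooth_mx U f ->
  smooth_mx U (fun x => normalize (f x)).
Proof.
move=> oU f0 sf; apply: smooth_scalemx => //; apply: smooth_rsqrt => // [x Ux|].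
  rewrite lt0r sqr_norm_ge0 andbT; apply: contraNneq (f0 x Ux).
  by move=> /sqr_norm_eq0 ->.
exact: (smooth_mulmx oU sf (smooth_trmx oU sf)).
Qed.

Lemma cross_smooth (V : normedModType R) (U : set V) n
    (A : V -> 'M[R]_(n, n.+1)) : open U -> smooth_mx U A ->
  smooth_mx U (fun x => cross (A x)).
Proof.
move=> oU sA i j.
have H := smooth_col_mx oU (smooth_cstmx U (delta_mx 0 j : 'rV[R]_n.+1)) sA.
have {}H := @smooth_det _ _ _ oU n.+1 _ H.
by apply: smooth_ext H => // x _; rewrite mxE.
Qed.

End Normalize.

Section Converse.
Variables (R : realType) (d : nat) (M : smooth_manifold R d).
Variable g : riemannian_metric M.
Implicit Types (a b c : chart R M d) (p : M).
Variable s : 'I_d.+1 -> M -> chart R M d -> 'rV[R]_d.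
Hypothesis sP : parseval_frame g s.
Variable O : set (chart R M d).
Hypothesis Oatlas : O `<=` atlas (s := M).
Hypothesis Ocover : forall p, exists2 a, O a & chart_dom a p.
Hypothesis Oor : forall a b p, O a -> O b -> chart_dom a p -> chart_dom b p ->
  0 < \det (transition_jacobian p a b).
#[local] Opaque transition_jacobian.

Let st j p : tangent p (s j p).
Proof. by have [/(_ j) [+ _] _] := sP; exact. Qed.

Definition vector_mx a p : 'M[R]_(d.+1, d) := \matrix_j s j p a.

(* The matrix of the analysis operator [v |-> (g p v (s j p))_j] in the
   chart [a]. *)
Definition analysis_mx a p : 'M[R]_(d, d.+1) := gram g p a *m (vector_mx a p)^T.

Lemma analysisE a p v j : chart_at p a -> tangent p v ->
  g p v (s j p) = (v a *m analysis_mx a p) 0 j.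
Proof.
move=> pa tv; rewrite (metricE g pa tv (st j p)) mulmxA.
by rewrite !mxE; apply: eq_bigr => k _; rewrite !mxE.
Qed.

(** The Parseval identity equates the quadratic forms of the two symmetric matrices; polarization
    makes the matrices equal. This is the isometry property of the analysis operator. *)
Lemma analysis_gram a p : chart_at p a ->
  analysis_mx a p *m (analysis_mx a p)^T = gram g p a.
Proof.
move=> pa; have [sgr gr] := gram_posdef g pa.
apply/eqP; rewrite -subr_eq0; apply/eqP/symmetric_form_eq0 => [|u].
  by rewrite raddfB /= trmx_mul trmxK sgr.
have tu := tangent_vector_tangent u pa.
have gu : g p (tangent_vector a p u) (tangent_vector a p u) = (u *m gram g p a *m u^T) 0 0.
  by rewrite (metricE g pa tu tu) tangent_vectorE.
have gu0 : 0 <= (u *m gram g p a *m u^T) 0 0.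
  by have [->|/gr/ltW//] := eqVneq u 0; rewrite !mul0mx mxE.
have [_ /(_ p _ tu)] := sP.
rewrite /metric_norm gu sqr_sqrtr // => H.
rewrite mulmxBr mulmxBl mxE [X in _ + X]mxE -{}H mulmxA -[_ *m _ *m u^T]mulmxA.
rewrite -trmx_mul sqr_norm_row; apply/eqP; rewrite subr_eq0; apply/eqP.
apply: eq_bigr => j _; rewrite real_normK ?num_real //.
by rewrite (analysisE _ pa tu) tangent_vectorE.
Qed.

(** The reconstruction formula: a tangent vector [v] is the sum of the [g p v (s j p) *: s j p].
    With [A] and [S] the two matrices and [G] the Gram matrix, [A A^T = G] reads [A S G = G], and
    [G] cancels. *)
Lemma analysis_vectorK a p : chart_at p a ->
  analysis_mx a p *m vector_mx a p = 1%:M.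
Proof.
move=> pa; have pg := gram_posdef g pa; have ug := posdef_unitmx pg.
apply: (can_inj (mulmxK ug)); rewrite mul1mx.
by rewrite -[RHS](analysis_gram pa) [in RHS]/analysis_mx trmx_mul trmxK pg.1 mulmxA.
Qed.

(** The coefficients [g p v (s j p)] do not depend on the chart in which [v] is expressed. *)
Lemma analysis_transition a b p : chart_at p a -> chart_at p b ->
  analysis_mx a p = transition_jacobian p a b *m analysis_mx b p.
Proof.
move=> pa pb; apply/row_matrixP => i; rewrite !rowE mulmxA.
have tv := tangent_vector_tangent (delta_mx 0 i) pa.
apply/rowP => j; have := analysisE j pa tv.
rewrite (analysisE j pb tv) (tangent_vectorE _ pa) => <-.
by rewrite {1}/tangent_vector (asboolT pb).
Qed.

Lemma analysis_smooth a : atlas a ->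
  smooth_mx (chart_image a) (fun x => analysis_mx a (chart_inv a x)) /\
  smooth_mx (chart_image a) (fun x => vector_mx a (chart_inv a x)).
Proof.
move=> aa; have oa := @chart_image_open _ _ _ a.
have sS : smooth_mx (chart_image a) (fun x => vector_mx a (chart_inv a x)).
  move=> j k; have [/(_ j) [_ /(_ a aa) sj] _] := sP.
  by apply: smooth_ext (smooth_coord oa k sj) => // x _; rewrite mxE.
split=> //.
exact: (smooth_mulmx oa (gram_smooth g aa) (smooth_trmx oa sS)).
Qed.

(** * The global unit normal *)

Definition local_normal a p := normalize (cross (analysis_mx a p)).

Lemma local_normal_transition a b p : chart_at p a -> chart_at p b ->
  local_normal a p =
  Num.sg (\det (transition_jacobian p a b)) *: local_normal b p.
Proof.
move=> pa pb; rewrite /local_normal (analysis_transition pa pb) cross_mull.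
by rewrite normalizeZ // det_transition_jacobian_neq0.
Qed.

Lemma cross_analysis_neq0 a p : chart_at p a -> cross (analysis_mx a p) != 0.
Proof.
by move=> pa; apply: cross_neq0; rewrite analysis_gram //; exact: gram_posdef.
Qed.

(** Chosen separately at each point, with no regularity in [p]; smoothness of [normal] must come
    from independence of this choice. *)
Definition oriented_chart p : chart R M d := s2val (cid2 (Ocover p)).

Definition normal p := local_normal (oriented_chart p) p.

Lemma oriented_chartP p :
  O (oriented_chart p) /\ chart_dom (oriented_chart p) p.
Proof. by rewrite /oriented_chart; case: cid2. Qed.

Lemma oriented_chart_at p : chart_at p (oriented_chart p).
Proof. by have [/Oatlas] := oriented_chartP p. Qed.

Lemma normal_sqr p : normal p *m (normal p)^T = 1%:M.
Proof. exact/normalize_sqr/cross_analysis_neq0/oriented_chart_at. Qed.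

Lemma analysis_normal a p : chart_at p a -> analysis_mx a p *m (normal p)^T = 0.
Proof.
move=> pa; rewrite (analysis_transition pa (oriented_chart_at p)).
rewrite /normal /local_normal /normalize linearZ /= -mulmxA -scalemxAr.
by rewrite cross_orthogonal scaler0 mulmx0.
Qed.

(** Passing from [b] to the chosen oriented chart costs no sign, as that Jacobian determinant is
    positive. Hence any oriented [b] may be used, in particular one that is fixed while [p]
    moves. *)
Lemma local_normalE a b p : chart_at p a -> O b -> chart_dom b p ->
  local_normal a p = Num.sg (\det (transition_jacobian p a b)) *: normal p.
Proof.
move=> pa Ob bp; have [Oc cp] := oriented_chartP p.
have pb : chart_at p b by split=> //; exact: Oatlas.
have pc := oriented_chart_at p.
rewrite (local_normal_transition pa pb) (local_normal_transition pb pc).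
have det0 := Oor Ob Oc bp cp.
by congr (_ *: _); rewrite (gtr0_sg det0) scale1r.
Qed.

(* In an arbitrary chart the global normal is the local one up to the sign of
   the Jacobian towards an oriented chart, which is locally constant. *)
Lemma normal_smooth a : atlas a ->
  smooth_on (chart_image a) (fun x => normal (chart_inv a x)).
Proof.
move=> aa k; apply: Cn_local => x ax; set p := chart_inv a x.
have pa : chart_at p a by exact: chart_at_inv.
(* One oriented chart [b] serves all points near [p], which makes the determinant [D] below
   continuous. *)
have [b Ob bp] := Ocover p.
have ab := Oatlas Ob.
have pb : chart_at p b by [].
pose D y := \det (transition_jacobian (chart_inv a y) a b).
have abx : overlap a b x by apply/overlapP.
have cD : {for x, continuous D} := det_transition_jacobian_smooth aa ab 0%N _ abx.
pose e := Num.sg (D x).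
have Dx0 : D x != 0 by exact: det_transition_jacobian_neq0.
have nD : \forall y \near x, 0 < e * D y.
  have ceD : (fun y => e * D y) @ x --> e * D x by exact: cvgMl_tmp cD.
  by apply: (cvgr_gt _ ceD); rewrite /e -normrEsg normr_gt0.
have nN : nbhs x (overlap a b `&` [set y | 0 < e * D y]).
  exact: filterI (near_overlap abx) nD.
have [N [oN Nx] NP] : exists2 N, open_nbhs x N &
    N `<=` overlap a b `&` [set y | 0 < e * D y] by move: nN; rewrite nbhsE.
exists N => //.
have NU : N `<=` chart_image a by move=> y /NP[/overlapP[]].
have [sA _] := analysis_smooth aa.
have H : smooth_on N (fun y => e *: local_normal a (chart_inv a y)).
  apply: smooth_row => // j.
  apply: (smooth_scalemx oN (smooth_cst N e)).
  apply: normalize_smooth => // [y /NU ay|].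
    by apply: cross_analysis_neq0; exact: chart_at_inv.
  apply: cross_smooth => // i l m.
  exact: Cn_sub NU (sA i l m).
apply: (smooth_ext oN _ H) k => y /set_mem /NP[/overlapP[ay by_] Dy].
rewrite (local_normalE (chart_at_inv aa ay) Ob by_) -/(D y) scalerA.
(* On [N] the sign of [D y] is the constant [e], so multiplying the smooth local normal by [e]
   undoes the sign in [local_normalE]. *)
have E (t : R) : 0 < e * t -> e * Num.sg t = 1.
  by move=> /gtr0_sg; rewrite sgrM /e sgr_id.
by rewrite (E _ Dy) scale1r.
Qed.

(** * The trivialization and its inverse *)

Definition frame_trivialization p (e : (chart R M d -> 'rV[R]_d) * R)
  : 'rV[R]_d.+1 := (\row_j g p e.1 (s j p)) + e.2 *: normal p.

(** The synthesis operator, adjoint to the analysis isometry, paired with the coefficient along the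
    normal. *)
Definition frame_trivialization_inv p (w : 'rV[R]_d.+1) :
  (chart R M d -> 'rV[R]_d) * R :=
  (\sum_j w 0 j *: s j p, (w *m (normal p)^T) 0 0).

Lemma frame_trivializationE a p v t : chart_at p a -> tangent p v ->
  frame_trivialization p (v, t) = v a *m analysis_mx a p + t *: normal p.
Proof.
move=> pa tv; congr (_ + _); apply/rowP => j.
by rewrite mxE (analysisE j pa tv).
Qed.

Lemma frame_trivialization_invE a p w :
  (frame_trivialization_inv p w).1 a = w *m vector_mx a p.
Proof.
rewrite /= fct_sumE mulmx_sum_row; apply: eq_bigr => j _.
by rewrite rowK.
Qed.

(** Since [vector_mx a p *m gram g p a] is the transpose of the analysis matrix, orthogonality of
    the normal to the image of the tangent space gives the claim after cancelling the invertible
    Gram matrix. *)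
Lemma normal_vector a p : chart_at p a -> normal p *m vector_mx a p = 0.
Proof.
move=> pa; have pg := gram_posdef g pa; have ug := posdef_unitmx pg.
apply: (can_inj (mulmxK ug)); rewrite mul0mx -mulmxA.
have -> : vector_mx a p *m gram g p a = (analysis_mx a p)^T.
  by rewrite trmx_mul trmxK pg.1.
by rewrite -[LHS]trmxK trmx_mul trmxK analysis_normal // trmx0.
Qed.

(** Stacking the normal on the analysis matrix gives a square matrix, for which the relations so far
    provide a right inverse; it is also a left inverse, and that product is the sum here. *)
Lemma vector_analysisK a p : chart_at p a ->
  vector_mx a p *m analysis_mx a p + (normal p)^T *m normal p = 1%:M.
Proof.
move=> pa.
have : (col_mx (normal p) (analysis_mx a p) : 'M[R]_d.+1) *m
       (row_mx (normal p)^T (vector_mx a p) : 'M[R]_d.+1) = 1%:M.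
  rewrite (@mul_col_row _ 1 d _ 1 d).
  rewrite normal_sqr normal_vector // analysis_normal // analysis_vectorK //.
  by rewrite -scalar_mx_block.
by move=> /mulmx1C <-; rewrite addrC -mul_row_col.
Qed.

Lemma frame_stable_trivialization :
  stable_trivialization frame_trivialization frame_trivialization_inv.
Proof.
split.
- move=> p c [v t] [v' t'] [/= tv _] [/= tv' _].
  have [a aa ap] := atlas_cover p; have pa : chart_at p a by [].
  rewrite !(@frame_trivializationE a) //; last exact: tangentZD.
  rewrite !fctE mulmxDl -scalemxAl scalerDr scalerDl scalerA.
  by rewrite addrACA.
- move=> p w; have [a aa ap] := atlas_cover p; have pa : chart_at p a by [].
  have tw : tangent p (frame_trivialization_inv p w).1 by exact: tangent_sum.
  split; first by split.
  rewrite [X in frame_trivialization _ X]surjective_pairing.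
  rewrite (frame_trivializationE _ pa tw) frame_trivialization_invE.
  rewrite -mul_scalar_mx -mx11_scalar -[in RHS](mulmx1 w) -(vector_analysisK pa).
  by rewrite mulmxDr !mulmxA.
- move=> p [v t] [/= tv _].
  have [a aa ap] := atlas_cover p; have pa : chart_at p a by [].
  rewrite (frame_trivializationE _ pa tv).
  rewrite [LHS]surjective_pairing; congr (_, _).
    apply: (tangent_inj pa) => //; first exact: tangent_sum.
    rewrite frame_trivialization_invE mulmxDl -mulmxA analysis_vectorK // mulmx1.
    by rewrite -scalemxAl normal_vector // scaler0 addr0.
  rewrite /= mulmxDl -mulmxA analysis_normal // mulmx0 add0r -scalemxAl.
  by rewrite normal_sqr !mxE mulr1.
- move=> a aa; have oa := @chart_image_open _ _ _ a.
  set U := chart_image a `*` setT.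
  have oU : open U by exact: open_setXT.
  have [sA _] := analysis_smooth aa.
  have sA1 : smooth_mx U (fun z => analysis_mx a (chart_inv a z.1)).
    move=> i j; apply: smooth_comp_fst (sA i j) => //.
  have sn1 : smooth_on U (fun z => normal (chart_inv a z.1)).
    apply: smooth_comp_fst (normal_smooth aa) => //.
  have su : smooth_mx U (fun z : 'rV[R]_d * ('rV[R]_d * R) => z.2.1).
    move=> i j; rewrite ord1; apply: smooth_coord => //.
    by apply: smooth_fst => //; apply: smooth_linear => // z; exact: cvg_snd.
  have stt : smooth_on U (fun z : 'rV[R]_d * ('rV[R]_d * R) => z.2.2).
    by apply: smooth_snd => //; apply: smooth_linear => // z; exact: cvg_snd.
  (* In the coordinates of the total space the map is [u *m A + t *: n], with [A] and [n] smooth in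
     the base coordinate and [u], [t] coordinate projections. *)
  apply: smooth_row => // j.
  have H := smoothD oU (smooth_mulmx oU su sA1 0 j)
                    (smoothM oU stt (smooth_coord oU j sn1)).
  apply: smooth_ext H => // z /set_mem [za _].
  have pa := chart_at_inv aa za.
  rewrite (frame_trivializationE _ pa) ?tangent_vectorE //; last first.
    exact: tangent_vector_tangent.
  by rewrite [RHS]mxE [X in _ = _ + X]mxE.
- move=> a aa; have oa := @chart_image_open _ _ _ a.
  set U := chart_image a `*` setT.
  have oU : open U by exact: open_setXT.
  have [_ sS] := analysis_smooth aa.
  have sS1 : smooth_mx U (fun z => vector_mx a (chart_inv a z.1)).
    move=> i j; apply: smooth_comp_fst (sS i j) => //.
  have sn1 : smooth_on U (fun z => normal (chart_inv a z.1)).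
    apply: smooth_comp_fst (normal_smooth aa) => //.
  have sw : smooth_on U (fun z : 'rV[R]_d * 'rV[R]_d.+1 => z.2).
    by apply: smooth_linear => // z; exact: cvg_snd.
  apply: smooth_pair => //.
    apply: smooth_row => // j.
    have H := smooth_mulmx oU (smooth_row_coord oU sw) sS1 0 j.
    apply: smooth_ext H => // z _.
    by rewrite frame_trivialization_invE.
  exact: (smooth_mulmx oU (smooth_row_coord oU sw)
            (smooth_trmx oU (smooth_row_coord oU sn1)) 0 0).
Qed.

End Converse.

Theorem theorem4p7 (R : realType) (d : nat) (M : smooth_manifold R d)
    (g : riemannian_metric M) (hor : orientable M) :
  (stably_parallelizable M ->
     exists s : 'I_d.+1 -> M -> chart R M d -> 'rV[R]_d, parseval_frame g s) /\
  (cohomology_trivial R M 'F_2 1 ->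
     (exists s : 'I_d.+1 -> M -> chart R M d -> 'rV[R]_d, parseval_frame g s) ->
     stably_parallelizable M).
Proof.
split=> [[Phi [Psi triv]]|_ [s sP]].
  by exists (parseval_of g Psi); exact: parseval_of_frame triv.
have [A [Aatlas Acover Aor]] := hor.
exists (frame_trivialization g s Acover), (frame_trivialization_inv g s Acover).
exact: frame_stable_trivialization.
Qed.
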